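(* An odd integer $n$ larger than $1$ is the length of the hypotenuse of a primitive Pythagorean triangle if and only if all the coefficients of the polynomial $r_2(n,q)$ (in the variable $q$) are non-negative.
   Context: For $n \geq 1$, $r_2(n,q)$ is defined as the coefficient of $t^n$ in the expansion, as a formal power series in $t$ with coefficients in $\mathbb{Z}[q,q^{-1}]$, $$\prod_{m=1}^{\infty} \frac{\left(1-(-qt)^m\right)^2}{\left(1+q(-qt)^m\right)\left(1+q^{-1}(-qt)^m\right)} = 1 + \sum_{n=1}^{\infty} r_2(n,q)\, t^n ;$$ each $r_2(n,q)$ is in fact a polynomial in $q$ with integer coefficients. An integer $n$ is the (length of the) hypotenuse of a primitive Pythagorean triangle if and only if there exist positive integers $u$ and $v$ such that $u^2+v^2=n^2$ and $u$, $v$, $n$ are relatively prime. *)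

(* Defs.v *)
From HB Require Import structures.
From mathcomp Require Import all_boot all_order all_algebra.
From mathcomp Require Import boolp.

Set Implicit Arguments.
Unset Strict Implicit.
Unset Printing Implicit Defensive.

Import Order.TTheory GRing.Theory Num.Theory.

Local Open Scope ring_scope.

(* R[[t]]; the variable t is fpsX below. *)
Record fps (R : Type) := FPS { fcoef : nat -> R }.

Lemma fpsP (R : Type) (f g : fps R) : fcoef f =1 fcoef g <-> f = g.
Proof.
split=> [|-> //]; case: f g => [f] [g] /= fg.
by congr FPS; apply: funext.
Qed.

HB.instance Definition _ (R : Type) := gen_eqMixin (fps R).
HB.instance Definition _ (R : Type) := gen_choiceMixin (fps R).

Section Zmodule.
Variable R : zmodType.
Implicit Types f g : fps R.

Definition fps_zero : fps R := FPS (fun=> 0).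
Definition fps_opp f : fps R := FPS (fun n => - fcoef f n).
Definition fps_add f g : fps R := FPS (fun n => fcoef f n + fcoef g n).

Lemma fps_addA : associative fps_add.
Proof. by move=> f g h; apply/fpsP => n /=; rewrite addrA. Qed.

Lemma fps_addC : commutative fps_add.
Proof. by move=> f g; apply/fpsP => n /=; rewrite addrC. Qed.

Lemma fps_add0 : left_id fps_zero fps_add.
Proof. by move=> f; apply/fpsP => n /=; rewrite add0r. Qed.

Lemma fps_addN : left_inverse fps_zero fps_opp fps_add.
Proof. by move=> f; apply/fpsP => n /=; rewrite addNr. Qed.

HB.instance Definition _ :=
  GRing.isZmodule.Build (fps R) fps_addA fps_addC fps_add0 fps_addN.

Lemma fcoef0 n : fcoef (0 : fps R) n = 0. Proof. by []. Qed.
Lemma fcoefN f n : fcoef (- f) n = - fcoef f n. Proof. by []. Qed.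
Lemma fcoefD f g n : fcoef (f + g) n = fcoef f n + fcoef g n.
Proof. by []. Qed.
Lemma fcoefB f g n : fcoef (f - g) n = fcoef f n - fcoef g n.
Proof. by []. Qed.

End Zmodule.

Section Ring.
Variable R : comNzRingType.
Implicit Types f g : fps R.

Definition fpsC (c : R) : fps R := FPS (fun n => if n == 0%N then c else 0).
Definition fpsX : fps R := FPS (fun n => (n == 1%N)%:R).
Definition fps_mul f g : fps R :=
  FPS (fun n => \sum_(i < n.+1) fcoef f i * fcoef g (n - i)%N).

(* Truncation modulo t^N: reduces ring identities to polynomials. *)
Let tr N f : {poly R} := \poly_(i < N) fcoef f i.

Let trM N f g n : (n < N)%N ->
  fcoef (fps_mul f g) n = (tr N f * tr N g)`_n.
Proof.
move=> ltnN; rewrite coefM; apply: eq_bigr => -[i /= lein] _.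
by rewrite !coef_poly (leq_trans lein ltnN) (leq_ltn_trans (leq_subr i n) ltnN).
Qed.

Let coef_tr N f n : (n < N)%N -> (tr N f)`_n = fcoef f n.
Proof. by move=> ltnN; rewrite coef_poly ltnN. Qed.

Lemma fps_mulC : commutative fps_mul.
Proof.
by move=> f g; apply/fpsP => n; rewrite !(trM _ _ (ltnSn n)) mulrC.
Qed.

Let eq_coefM (p p' s s' : {poly R}) n :
    (forall i, (i <= n)%N -> p`_i = p'`_i) ->
    (forall i, (i <= n)%N -> s`_i = s'`_i) ->
  (p * s)`_n = (p' * s')`_n.
Proof.
move=> ep es; rewrite !coefM; apply: eq_bigr => -[i /= lein] _.
by rewrite ep // es // leq_subr.
Qed.

Lemma fps_mulA : associative fps_mul.
Proof.
move=> f g h; apply/fpsP => n; rewrite !(trM _ _ (ltnSn n)).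
transitivity (tr n.+1 f * (tr n.+1 g * tr n.+1 h))`_n.
  by apply: eq_coefM => // i lein; rewrite coef_tr // (trM _ _ (N := n.+1)).
rewrite mulrA; apply: eq_coefM => // i lein.
by rewrite coef_tr // (trM _ _ (N := n.+1)).
Qed.

Lemma fps_mulCE (c : R) f n : fcoef (fps_mul (fpsC c) f) n = c * fcoef f n.
Proof.
rewrite /= big_ord_recl subn0 /= big1 ?addr0 // => i _.
by rewrite /= mul0r.
Qed.

Lemma fps_mul1 : left_id (fpsC 1) fps_mul.
Proof. by move=> f; apply/fpsP => n; rewrite fps_mulCE mul1r. Qed.

Lemma fps_mulDl : left_distributive fps_mul +%R.
Proof.
move=> f g h; apply/fpsP => n; rewrite fcoefD /= -big_split /=.
by apply: eq_bigr => i _; rewrite mulrDl.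
Qed.

Lemma fps_1neq0 : fpsC 1 != 0.
Proof.
apply/eqP => /fpsP /(_ 0%N) /= /eqP.
by rewrite oner_eq0.
Qed.

HB.instance Definition _ := GRing.Zmodule_isComNzRing.Build (fps R)
  fps_mulA fps_mulC fps_mul1 fps_mulDl fps_1neq0.

Lemma fcoef1 n : fcoef (1 : fps R) n = (n == 0%N)%:R.
Proof. by case: n. Qed.

Lemma fcoefM f g n :
  fcoef (f * g) n = \sum_(i < n.+1) fcoef f i * fcoef g (n - i)%N.
Proof. by []. Qed.

Lemma fcoefCM (c : R) f n : fcoef (fpsC c * f) n = c * fcoef f n.
Proof. exact: fps_mulCE. Qed.

Lemma fcoefXM f n :
  fcoef (fpsX * f) n = if n is n'.+1 then fcoef f n' else 0.
Proof.
rewrite fcoefM big_ord_recl /= mul0r add0r.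
case: n => [|n]; first by rewrite big_ord0.
rewrite big_ord_recl /= mul1r subSS subn0 big1 ?addr0 // => i _.
by rewrite /= mul0r.
Qed.

Lemma fcoefCX (c : R) m n :
  fcoef ((fpsC c * fpsX) ^+ m) n = if n == m then c ^+ m else 0.
Proof.
elim: m n => [|m IHm] n; first by rewrite !expr0.
rewrite exprS -mulrA fcoefCM fcoefXM.
case: n => [|n]; first by rewrite mulr0.
by rewrite IHm eqSS; case: eqP => _; rewrite ?exprS ?mulr0.
Qed.

(* t-adic convergence of the infinite product F_1 F_2 F_3 ... to P. *)
Definition is_infprod (F : nat -> fps R) (P : fps R) :=
  forall n, exists N, forall M, (N <= M)%N ->
    fcoef (\prod_(1 <= m < M.+1) F m) n = fcoef P n.

Lemma is_infprod_uniq (F : nat -> fps R) (P Q : fps R) :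
  is_infprod F P -> is_infprod F Q -> P = Q.
Proof.
move=> FP FQ; apply/fpsP => n; have [[N NP] [N' NQ]] := (FP n, FQ n).
by rewrite -(NP (maxn N N')) ?leq_maxl // NQ ?leq_maxr.
Qed.

End Ring.

Section Inverse.
Variable R : comUnitRingType.
Implicit Types f g : fps R.

Definition fps_unit : {pred fps R} := fun f => fcoef f 0 \is a GRing.unit.

(* The coefficients b_n, ..., b_0 of 1/f, in this order. *)
Fixpoint fps_invs f n : seq R :=
  if n is n'.+1 then
    let s := fps_invs f n' in
    - (fcoef f 0)^-1 * (\sum_(i < n) fcoef f i.+1 * s`_i) :: s
  else [:: (fcoef f 0)^-1].

Definition fps_inv f : fps R :=
  if fps_unit f then FPS (fun n => (fps_invs f n)`_0) else f.

Lemma nth_fps_invs f n i : (i <= n)%N ->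
  (fps_invs f n)`_i = (fps_invs f (n - i)%N)`_0.
Proof. by elim: n i => [|n IHn] [|i] //= /IHn ->. Qed.

Lemma fps_mulV : {in fps_unit, left_inverse 1 fps_inv *%R}.
Proof.
move=> f Uf; rewrite mulrC; apply/fpsP => n.
have Uf' : fps_unit f by [].
rewrite fcoefM fcoef1 big_ord_recl /= /bump /= subn0 /fps_inv Uf' /=.
case: n => [|n] /=; first by rewrite big_ord0 addr0 mulrV.
rewrite mulNr mulrN mulrA mulrV // mul1r.
apply/eqP; rewrite addrC subr_eq0; apply/eqP; apply: eq_bigr => i _.
by rewrite add1n subSS [in RHS]nth_fps_invs // -ltnS.
Qed.

Lemma fps_unitPl f g : g * f = 1 -> fps_unit f.
Proof.
move=> /fpsP/(_ 0%N); rewrite fcoefM fcoef1 big_ord1 /= => gf.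
by apply/unitrPr; exists (fcoef g 0); rewrite mulrC.
Qed.

Lemma fps_inv_out : {in [predC fps_unit], fps_inv =1 id}.
Proof.
by move=> f /negP nUf; rewrite /fps_inv; case: ifP.
Qed.

HB.instance Definition _ := GRing.ComNzRing_hasMulInverse.Build (fps R)
  fps_mulV fps_unitPl fps_inv_out.

Lemma fps_unitE f : (f \is a GRing.unit) = (fcoef f 0 \is a GRing.unit).
Proof. by []. Qed.

End Inverse.

(* Z[q, 1/q] is taken inside the field {fraction {poly int}} = Q(q): the
   expansion of the product below has coefficients in this subring, indeed in
   the image of {poly int} under p |-> p%:F (r2_exists). *)
Notation Qq := {fraction {poly int}}.
Notation "x %:F" := (tofrac x) : ring_scope.

Definition q : Qq := 'X%:F.

Definition r2_factor (m : nat) : fps Qq :=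
  let u := (fpsC (- q) * fpsX Qq) ^+ m in
  (1 - u) ^+ 2 / ((1 + fpsC q * u) * (1 + fpsC q^-1 * u)).

Section Existence.

(* f has coefficients in Z[q] and f = 1 modulo t^m. *)
Let good m (f : fps Qq) :=
  (forall n, exists p : {poly int}, fcoef f n = p%:F) /\
  (forall n, (n < m)%N -> fcoef f n = fcoef (1 : fps Qq) n).

Let good1 m : good m 1.
Proof.
split=> // n; exists (n == 0%N)%:R.
by rewrite fcoef1 rmorph_nat.
Qed.

Let intM (f g : fps Qq) :
    (forall n, exists p : {poly int}, fcoef f n = p%:F) ->
    (forall n, exists p : {poly int}, fcoef g n = p%:F) ->
  forall n, exists p : {poly int}, fcoef (f * g) n = p%:F.
Proof.
move=> /choice[a fa] /choice[b gb] n.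
exists (\sum_(i < n.+1) a i * b (n - i)%N).
rewrite fcoefM rmorph_sum; apply: eq_bigr => i _.
by rewrite /= rmorphM fa gb.
Qed.

Let oneM m (f g : fps Qq) n :
    (forall n, (n < m)%N -> fcoef g n = fcoef (1 : fps Qq) n) ->
  (n < m)%N -> fcoef (f * g) n = fcoef f n.
Proof.
move=> g1 ltnm; rewrite -[in RHS](mulr1 f) !fcoefM; apply: eq_bigr => i _.
by rewrite g1 // (leq_ltn_trans (leq_subr i n) ltnm).
Qed.

Let goodM m f g : good m f -> good m g -> good m (f * g).
Proof.
move=> [fi f1] [gi g1]; split; first exact: intM.
by move=> n ltnm; rewrite (oneM f g1) // f1.
Qed.

Let good_unit m f : (0 < m)%N -> good m f -> f \is a GRing.unit.
Proof. by move=> m0 [_ f1]; rewrite fps_unitE f1 // fcoef1 unitr1. Qed.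

Let goodV m f : (0 < m)%N -> good m f -> good m f^-1.
Proof.
move=> m0 gf; have Uf := good_unit m0 gf; case: gf => fi f1; split; last first.
  by move=> n ltnm; rewrite -(oneM f^-1 f1) // mulVr.
elim/ltn_ind => n IHn.
have [a fa] := choice fi.
have : exists b : nat -> {poly int},
    forall i, (i < n)%N -> fcoef f^-1 i = (b i)%:F.
  suff /choice[b vb] : forall i, exists p : {poly int},
      (i < n)%N -> fcoef f^-1 i = p%:F by exists b.
  move=> i; case: (ltnP i n) => [/IHn[p ->]|_]; first by exists p.
  by exists 0.
case=> b vb; have /fpsP/(_ n) := mulVr Uf.
rewrite fcoefM fcoef1 big_ord_recr /= subnn (f1 0%N m0) fcoef1 mulr1 => E.
exists ((n == 0%N)%:R - \sum_(i < n) b i * a (n - i)%N).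
rewrite rmorphB rmorph_nat rmorph_sum /= -E.
rewrite [X in _ = _ - X](_ : _ = \sum_(i < n) fcoef f^-1 i * fcoef f (n - i)%N).
  by rewrite [RHS]addrC addKr.
by apply: eq_bigr => i _; rewrite rmorphM /= vb // fa.
Qed.

Let good_mono m (c : Qq) : (exists p : {poly int}, c * (- q) ^+ m = p%:F) ->
  good m (1 + fpsC c * (fpsC (- q) * fpsX Qq) ^+ m).
Proof.
move=> [p cp]; split=> n; rewrite fcoefD fcoefCM fcoefCX fcoef1.
  exists ((n == 0%N)%:R + if n == m then p else 0).
  rewrite rmorphD rmorph_nat /=; congr (_ + _).
  by case: eqP => _; rewrite // mulr0 rmorph0.
by move=> ltnm; rewrite (ltn_eqF ltnm) mulr0 addr0.
Qed.

Let q_neq0 : q != 0.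
Proof. by rewrite tofrac_eq0 polyX_eq0. Qed.

Let qX m : (- q) ^+ m = ((- 'X) ^+ m)%:F.
Proof. by rewrite rmorphXn rmorphN. Qed.

Let good_den1 m : good m (1 + fpsC q * (fpsC (- q) * fpsX Qq) ^+ m).
Proof. by apply: good_mono; exists ('X * (- 'X) ^+ m); rewrite rmorphM /= -qX. Qed.

Let good_den2 m : (0 < m)%N ->
  good m (1 + fpsC q^-1 * (fpsC (- q) * fpsX Qq) ^+ m).
Proof.
case: m => // m _; apply: good_mono; exists (- (- 'X) ^+ m).
by rewrite exprS mulrA mulrN mulVf // mulN1r rmorphN /= -qX.
Qed.

Lemma r2_factor_den_unit m : (0 < m)%N ->
  let u := (fpsC (- q) * fpsX Qq) ^+ m in
  (1 + fpsC q * u) * (1 + fpsC q^-1 * u) \is a GRing.unit.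
Proof.
by move=> m0 /=; apply: (good_unit m0); apply: goodM => //; apply: good_den2.
Qed.

Let good_factor m : (0 < m)%N -> good m (r2_factor m).
Proof.
move=> m0; have gN : good m (1 - (fpsC (- q) * fpsX Qq) ^+ m).
  have -> : - (fpsC (- q) * fpsX Qq) ^+ m
            = fpsC (-1) * (fpsC (- q) * fpsX Qq) ^+ m.
    by apply/fpsP => n; rewrite fcoefN fcoefCM mulN1r.
  by apply: good_mono; exists (- (- 'X) ^+ m); rewrite mulN1r rmorphN /= -qX.
rewrite /r2_factor expr2; apply: goodM; first exact: goodM.
by apply: goodV => //; apply: goodM => //; apply: good_den2.
Qed.

Lemma r2_exists : exists r : nat -> {poly int},
  is_infprod r2_factor (FPS (fun n => (r n)%:F)).
Proof.
have int_prod M n : exists p : {poly int},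
    fcoef (\prod_(1 <= m < M.+1) r2_factor m) n = p%:F.
  elim: M n => [|M IHM].
    by rewrite big_geq //; exact: (good1 0).1.
  rewrite big_nat_recr //; apply: intM => //.
  exact: (good_factor (ltn0Sn M)).1.
have [r rP] := choice (fun n => int_prod n n).
exists r => n; exists n; elim=> [|M IHM].
  by rewrite leqn0 => /eqP ->; rewrite [RHS]/= -rP.
rewrite leq_eqVlt ltnS => /predU1P[->|lenM]; first by rewrite [RHS]/= -rP.
rewrite big_nat_recr // (oneM _ (good_factor (ltn0Sn M)).2) ?ltnS //.
exact: IHM.
Qed.

End Existence.

(* Determined by r2P, thanks to is_infprod_uniq and injectivity of p |-> p%:F. *)
Definition r2 : nat -> {poly int} := sval (cid r2_exists).

Lemma r2P : is_infprod r2_factor (FPS (fun n => (r2 n)%:F)).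
Proof. by rewrite /r2; case: cid. Qed.

Definition primitive_hypotenuse (n : nat) :=
  exists u v : nat, [/\ (0 < u)%N, (0 < v)%N,
    (u ^ 2 + v ^ 2 = n ^ 2)%N & gcdn (gcdn u v) n = 1%N].

(* Main.v *)
From HB Require Import structures.
Require Import Defs.
From mathcomp Require Import all_boot all_order all_algebra.
From mathcomp Require Import finfield boolp zify ring.

(** Put z = -q and x = -qt, so that the generating function of the r_2(n,q) is
    the product over m of (1 - x^m)^2 / ((1 - z x^m)(1 - z^-1 x^m)), which is
    the generating function of the crank of partitions up to a factor.  Its
    expansion into partial fractions in z is
<<
      1 + sum_(n >= 1) (-1)^n x^(n(n+1)/2)
            ((1 - z) / (1 - z x^n) + (1 - z^-1) / (1 - z^-1 x^n))
>>
    and expanding the geometric series shows that r_2(N,q) is the sum, over the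
    factorizations 2N = n m with n < m of opposite parity, of the blocks
<<
      (-1)^(n+N+k) (q^(N+k) + q^(N+k+1) + q^(N-k) + q^(N-k-1))
>>
    where m = n + 1 + 2k (crank_expansion_mod, r2E).

    Different factorizations have different k, and two values of k are never
    consecutive (crank_pair_inj, crank_pair_gap).  Hence the blocks do not
    cancel: the coefficient at N+k+1 is the sign of the block k alone, and the
    coefficients of r_2(N,q) are non-negative exactly when every block has a
    positive sign (r2_ge0P).  For odd N a factorization 2N = n m amounts to the
    choice of the odd one among n and m, a divisor d of N, and the sign is
    positive exactly when d = 1 modulo 4 (crank_signs_divisors).

    It remains to see that an odd n > 1 is a primitive hypotenuse exactly when
    all its divisors are 1 modulo 4 (primitive_hypotenuseP).  A prime p = 3
    modulo 4 dividing u^2 + v^2 divides both u and v, as -1 is not a square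
    modulo p.  Conversely a product of primes that are 1 modulo 4 is a sum
    a^2 + b^2 of two coprime squares, by the theorem of Fermat for primes and
    the product formula for sums of two squares, and then
    n^2 = (a^2 - b^2)^2 + (2ab)^2. *)

Import Order.TTheory GRing.Theory Num.Theory.

Set Implicit Arguments.
Unset Strict Implicit.
Unset Printing Implicit Defensive.

Local Open Scope ring_scope.

(** * Partial fractions of the crank product *)

Section CrankExpansion.
Variables (R : comUnitRingType) (x : R).
Hypothesis unit_x : forall i, 1 - x ^+ i.+1 \is a GRing.unit.

(** The quotient of the Gaussian binomials (2m choose m+n) and (2m choose m).
    As m grows it tends to 1, which turns the finite partial fraction
    expansion below into the infinite one. *)
Definition binratio (m n : nat) : R :=
  \prod_(i < n) ((1 - x ^+ (m - i)) / (1 - x ^+ (m + i).+1)).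

Lemma binratioS m n :
  binratio m n.+1 * (1 - x ^+ (m + n).+1) = binratio m n * (1 - x ^+ (m - n)).
Proof. by rewrite /binratio big_ord_recr /= -!mulrA mulVr // mulr1. Qed.

Lemma binratio_recl m n : (n <= m)%N ->
  binratio m n * (1 - x ^+ m.+1) ^+ 2 =
  binratio m.+1 n * ((1 - x ^+ (m.+1 - n)) * (1 - x ^+ (m.+1 + n))).
Proof.
elim: n => [|n IHn] ltnm.
  by rewrite /binratio !big_ord0 subn0 addn0 expr2.
apply: (mulIr (unit_x (m + n))).
rewrite [LHS]mulrAC binratioS mulrAC (IHn (ltnW ltnm)) subSS addSn.
have -> : binratio m.+1 n * ((1 - x ^+ (m.+1 - n)) * (1 - x ^+ (m + n).+1))
           * (1 - x ^+ (m - n))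
        = binratio m.+1 n * (1 - x ^+ (m.+1 - n))
           * ((1 - x ^+ (m - n)) * (1 - x ^+ (m + n).+1)) by ring.
by rewrite -binratioS addSn !addnS; ring.
Qed.

(** The partial sums of the vanishing sum in sum_binratio have a closed form
    containing the factor 1 - x^(m-n), which is 0 at n = m. *)
Lemma sum_binratio_partial m n : (n <= m)%N ->
  (1 + \sum_(i < n) (-1) ^+ i.+1 * x ^+ 'C(i.+1, 2) * (1 + x ^+ i.+1)
                     * binratio m i.+1) * (1 - x ^+ m) =
  (-1) ^+ n * x ^+ 'C(n.+1, 2) * binratio m n * (1 - x ^+ (m - n)).
Proof.
elim: n => [|n IHn] ltnm.
  by rewrite big_ord0 /binratio big_ord0 subn0 bin_small // !expr0; ring.
rewrite big_ord_recr /= addrA mulrDl (IHn (ltnW ltnm)).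
rewrite -[_ * binratio m n * _]mulrA -binratioS.
have -> : 'C(n.+2, 2) = ('C(n.+1, 2) + n.+1)%N by rewrite binS bin1.
have -> : x ^+ m = x ^+ (m - n.+1) * x ^+ n.+1 by rewrite -exprD subnK.
have -> : x ^+ (m + n).+1 = x ^+ (m - n.+1) * x ^+ n.+1 * x ^+ n.+1.
  by rewrite -!exprD subnK // addnS.
by rewrite exprD [(-1) ^+ n.+1]exprS; ring.
Qed.

(** Folded about its middle term, this is the q-binomial theorem for the
    product of the 1 - y x^j, -m-1 <= j <= m, at y = 1, where the factor j = 0
    vanishes. *)
Lemma sum_binratio m :
  1 + \sum_(i < m.+1) (-1) ^+ i.+1 * x ^+ 'C(i.+1, 2) * (1 + x ^+ i.+1)
                     * binratio m.+1 i.+1 = 0.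
Proof.
apply: (mulIr (unit_x m)).
by rewrite sum_binratio_partial // subnn expr0 subrr mulr0 mul0r.
Qed.

Lemma binratio_mod m n : (n <= m)%N ->
  exists h, binratio m n = 1 + x ^+ (m - n).+1 * h.
Proof.
elim: n => [|n IHn] ltnm.
  by exists 0; rewrite /binratio big_ord0 mulr0 addr0.
have [h hE] := IHn (ltnW ltnm).
exists ((x * h * (1 - x ^+ (m - n)) + x ^+ n.*2.+1 - 1)
        / (1 - x ^+ (m + n).+1)).
apply: (mulIr (unit_x (m + n))).
rewrite binratioS hE [RHS]mulrDl mul1r -[X in _ = _ + X]mulrA divrK //.
have -> : x ^+ (m - n).+1 = x ^+ (m - n) * x by rewrite exprSr.
have -> : (m + n).+1 = ((m - n) + n.*2.+1)%N.
  by rewrite addnS -addnn addnA subnK // ltnW.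
by rewrite subnSK // exprD; ring.
Qed.

Variables z z' : R.
Hypothesis zz' : z * z' = 1.
Hypothesis unit_z : forall i, 1 - z * x ^+ i.+1 \is a GRing.unit.
Hypothesis unit_z' : forall i, 1 - z' * x ^+ i.+1 \is a GRing.unit.

Definition crank_den (n : nat) : R := (1 - z * x ^+ n) * (1 - z' * x ^+ n).

Lemma unit_crank_den n : crank_den n.+1 \is a GRing.unit.
Proof. by rewrite unitrM unit_z unit_z'. Qed.

(** This is the partial fraction decomposition of the product of the inverses
    of crank_den n and crank_den m, with denominators cleared. *)
Lemma crank_den_split n m : (n <= m)%N ->
  (1 - x ^+ (m - n)) * (1 - x ^+ (m + n))
  = crank_den m - x ^+ (m - n) * crank_den n.
Proof.
by move=> /subnK <-; rewrite addnK /crank_den !exprD; ring: zz'.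
Qed.

Definition crank_term m n : R :=
  (-1) ^+ n * x ^+ 'C(n.+1, 2) * (1 + x ^+ n) * binratio m n.

Lemma crank_termS m n : (n < m)%N ->
  crank_term m n.+1 / crank_den n.+1
    * ((1 - x ^+ m.+1) ^+ 2 / crank_den m.+1) =
  crank_term m.+1 n.+1 / crank_den n.+1
  - crank_term m.+1 n.+1 * x ^+ (m.+1 - n.+1) / crank_den m.+1.
Proof.
move=> ltnm.
apply: (mulIr (unit_crank_den n)); apply: (mulIr (unit_crank_den m)).
set Dn := crank_den n.+1; set Dm := crank_den m.+1.
have Un : Dn^-1 * Dn = 1 by rewrite mulVr // unit_crank_den.
have Um : Dm^-1 * Dm = 1 by rewrite mulVr // unit_crank_den.
transitivity (crank_term m n.+1 * (1 - x ^+ m.+1) ^+ 2); first by ring: Un Um.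
transitivity (crank_term m.+1 n.+1 * (Dm - x ^+ (m.+1 - n.+1) * Dn)).
  rewrite -crank_den_split ?(leqW ltnm) // /crank_term -!mulrA.
  by rewrite (binratio_recl ltnm) mulrA.
by ring: Un Um.
Qed.

(** By induction on M: splitting each fraction of the sum for M multiplied by
    the last factor gives the fractions with denominators crank_den n, n <= M,
    of the sum for M+1, while the contributions to the denominator crank_den (M+1)
    add up to the new term by sum_binratio. *)
Lemma crank_partial_fractions M :
  \prod_(1 <= m < M.+1) ((1 - x ^+ m) ^+ 2 / crank_den m) =
  1 + (1 - z) * (1 - z') *
      \sum_(i < M) crank_term M i.+1 / crank_den i.+1.
Proof.
elim: M => [|M IHM]; first by rewrite big_geq // big_ord0 mulr0 addr0.
rewrite big_nat_recr //= {}IHM mulrDl mul1r -mulrA mulr_suml.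
rewrite (eq_bigr _ (fun i _ => crank_termS (ltn_ord i))).
rewrite sumrB -mulr_suml.
have -> : \sum_(i < M) crank_term M.+1 i.+1 * x ^+ (M.+1 - i.+1)
    = - x ^+ M.+1 - crank_term M.+1 M.+1.
  have := sum_binratio M; rewrite big_ord_recr /=.
  set S := \sum_(i < M) _ => sumE.
  transitivity (x ^+ M.+1 * S).
    rewrite mulr_sumr; apply: eq_bigr => i _; rewrite /crank_term binS bin1.
    have /subnK <- : (i.+1 <= M.+1)%N by rewrite ltnS ltnW.
    by rewrite addnK !exprD; ring.
  rewrite /crank_term binS bin1 exprD.
  move: ((-1) ^+ M.+1) (binratio _ _) sumE => e B sumE.
  transitivity
    (x ^+ M.+1 * (1 + (S + e * x ^+ 'C(M.+1, 2) * (1 + x ^+ M.+1) * B))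
     - x ^+ M.+1 - e * (x ^+ 'C(M.+1, 2) * x ^+ M.+1) * (1 + x ^+ M.+1) * B).
    by ring.
  by rewrite sumE; ring.
rewrite [in RHS]big_ord_recr /=.
have UM : (crank_den M.+1)^-1 * crank_den M.+1 = 1.
  by rewrite mulVr // unit_crank_den.
apply: (mulIr (unit_crank_den M)).
transitivity ((1 - x ^+ M.+1) ^+ 2 + (1 - z) * (1 - z') * x ^+ M.+1
  + (1 - z) * (1 - z') *
      ((\sum_(i < M) crank_term M.+1 i.+1 / crank_den i.+1) * crank_den M.+1
       + crank_term M.+1 M.+1)).
  by ring: UM.
have -> : (1 - x ^+ M.+1) ^+ 2 + (1 - z) * (1 - z') * x ^+ M.+1
        = crank_den M.+1 by rewrite /crank_den; ring: zz'.
by ring: UM.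
Qed.

Lemma geometric_mod y y' k n :
    (forall i, 1 - y * x ^+ i.+1 \is a GRing.unit) ->
  exists h, y' / (1 - y * x ^+ n.+1)
    = \sum_(j < k) y' * y ^+ j * x ^+ (n.+1 * j) + x ^+ (n.+1 * k) * h.
Proof.
move=> Uy; exists (y' * y ^+ k / (1 - y * x ^+ n.+1)).
apply: (mulIr (Uy n)); rewrite mulrDl [in RHS]mulrA !divrK //.
rewrite (eq_bigr (fun j : 'I_k => y' * (y * x ^+ n.+1) ^+ j)); last first.
  by move=> j _; rewrite exprMn exprM mulrA.
have := subrX1 (y * x ^+ n.+1) k; set S := \sum_(i < k) _; move=> SE.
rewrite (_ : \sum_(i < k) _ = y' * S); last by rewrite mulr_sumr.
transitivity
  (y' + y' * (((y * x ^+ n.+1) ^+ k - 1) - (y * x ^+ n.+1 - 1) * S)).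
  by rewrite SE; ring.
by rewrite exprMn -exprM; ring.
Qed.

Lemma crank_fractionE n :
  (1 - z) * (1 - z') * ((1 + x ^+ n.+1) / crank_den n.+1) =
  (1 - z) / (1 - z * x ^+ n.+1) + (1 - z') / (1 - z' * x ^+ n.+1).
Proof.
have := mulVr (unit_z n); have := mulVr (unit_z' n); have := unit_z' n.
have := unit_z n; rewrite /crank_den.
set a := 1 - z * _; set a' := 1 - z' * _ => Ua Ua' Va' Va.
rewrite invrM //; apply: (mulIr Ua); apply: (mulIr Ua').
transitivity ((1 - z) * (1 - z') * (1 + x ^+ n.+1)); first by ring: Va Va'.
transitivity ((1 - z) * a' + (1 - z') * a); last by ring: Va Va'.
by rewrite /a /a'; ring: zz'.
Qed.

(** Replacing binratio by 1 changes the term by a multiple of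
    x^('C(n+2, 2) + M - n), hence of x^(M+1) as 'C(n+2, 2) > n; so does cutting
    the geometric series after M terms, as 'C(n+2, 2) + (n+1) M > M. *)
Lemma crank_term_mod M n : (n < M)%N ->
  exists h, (1 - z) * (1 - z') * (crank_term M n.+1 / crank_den n.+1) =
  \sum_(k < M) (-1) ^+ n.+1 * x ^+ ('C(n.+2, 2) + n.+1 * k)
                 * ((1 - z) * z ^+ k + (1 - z') * z' ^+ k) + x ^+ M.+1 * h.
Proof.
move=> ltnM; have [b bE] := binratio_mod ltnM.
have [h hE] := geometric_mod (1 - z) M n unit_z.
have [h' h'E] := geometric_mod (1 - z') M n unit_z'.
have leC : (n.+1 <= 'C(n.+2, 2))%N by rewrite binS bin1 leq_addl.
have leM : (M.+1 <= 'C(n.+2, 2) + n.+1 * M)%N.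
  by rewrite -[M.+1]add1n leq_add ?(leq_trans _ leC) // leq_pmull.
have E1 : x ^+ 'C(n.+2, 2) * x ^+ (M - n.+1).+1
        = x ^+ M.+1 * x ^+ ('C(n.+2, 2) - n.+1).
  by rewrite -!exprD; congr (_ ^+ _); lia.
have E2 : x ^+ 'C(n.+2, 2) * x ^+ (n.+1 * M)
        = x ^+ M.+1 * x ^+ ('C(n.+2, 2) + n.+1 * M - M.+1).
  by rewrite -!exprD subnKC.
set F := (1 - z) * (1 - z') * ((1 + x ^+ n.+1) / crank_den n.+1).
have FE : F = \sum_(j < M) (1 - z) * z ^+ j * x ^+ (n.+1 * j)
    + \sum_(j < M) (1 - z') * z' ^+ j * x ^+ (n.+1 * j)
    + x ^+ (n.+1 * M) * (h + h').
  by rewrite /F crank_fractionE hE h'E; ring.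
have -> : \sum_(k < M) (-1) ^+ n.+1 * x ^+ ('C(n.+2, 2) + n.+1 * k)
      * ((1 - z) * z ^+ k + (1 - z') * z' ^+ k)
    = (-1) ^+ n.+1 * x ^+ 'C(n.+2, 2)
      * (\sum_(j < M) (1 - z) * z ^+ j * x ^+ (n.+1 * j)
         + \sum_(j < M) (1 - z') * z' ^+ j * x ^+ (n.+1 * j)).
  rewrite -big_split mulr_sumr; apply: eq_bigr => k _ /=.
  by rewrite exprD; move: ((-1) ^+ n.+1) => e; ring.
rewrite /crank_term bE; move: ((-1) ^+ n.+1) => e.
exists (e * (x ^+ ('C(n.+2, 2) - n.+1) * F * b
             + x ^+ ('C(n.+2, 2) + n.+1 * M - M.+1) * (h + h'))).
transitivity (e * x ^+ 'C(n.+2, 2) * F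
              + e * (x ^+ 'C(n.+2, 2) * x ^+ (M - n.+1).+1) * F * b).
  by rewrite /F; ring.
rewrite E1 {1}FE.
set S := \sum_(j < M) _; set S' := \sum_(j < M) _.
transitivity (e * x ^+ 'C(n.+2, 2) * (S + S')
              + e * (x ^+ 'C(n.+2, 2) * x ^+ (n.+1 * M)) * (h + h')
              + e * (x ^+ M.+1 * x ^+ ('C(n.+2, 2) - n.+1)) * F * b).
  by ring.
by rewrite E2; ring.
Qed.

Lemma crank_expansion_mod M : exists h,
  \prod_(1 <= m < M.+1) ((1 - x ^+ m) ^+ 2 / crank_den m) =
  1 + \sum_(n < M) \sum_(k < M)
        (-1) ^+ n.+1 * x ^+ ('C(n.+2, 2) + n.+1 * k)
          * ((1 - z) * z ^+ k + (1 - z') * z' ^+ k) + x ^+ M.+1 * h.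
Proof.
pose c (n : 'I_M) := cid (crank_term_mod (ltn_ord n)).
exists (\sum_n sval (c n)); rewrite crank_partial_fractions -addrA.
rewrite 2!mulr_sumr -big_split; congr (1 + _).
by apply: eq_bigr => n _; exact: (svalP (c n)).
Qed.

End CrankExpansion.

(** * Constants among the power series *)

Section FpsConstants.
Variable R : comNzRingType.

Lemma fpsC_is_zmod_morphism : zmod_morphism (@fpsC R).
Proof. by move=> c d; apply/fpsP => n /=; case: eqP; rewrite ?subr0. Qed.

Lemma fpsC_is_monoid_morphism : monoid_morphism (@fpsC R).
Proof.
split=> // c d; apply/fpsP => n; rewrite fcoefCM /=.
by case: eqP; rewrite ?mulr0.
Qed.

HB.instance Definition _ :=
  GRing.isZmodMorphism.Build R (fps R) (@fpsC R) fpsC_is_zmod_morphism.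
HB.instance Definition _ :=
  GRing.isMonoidMorphism.Build R (fps R) (@fpsC R) fpsC_is_monoid_morphism.

Lemma fcoef_CXM (c : R) m f n : (n < m)%N ->
  fcoef ((fpsC c * fpsX R) ^+ m * f) n = 0.
Proof.
elim: m n => // m IHm n; rewrite ltnS exprS -!mulrA fcoefCM fcoefXM.
by case: n => [|n] ltnm; rewrite ?mulr0 // IHm ?mulr0.
Qed.

Lemma one_sub_fpsCN (c : R) f : 1 - fpsC (- c) * f = 1 + fpsC c * f.
Proof. by rewrite rmorphN mulNr opprK. Qed.

Lemma fps_constE (a b : R) n k :
  (-1) ^+ n * ((1 - fpsC a) * fpsC a ^+ k + (1 - fpsC b) * fpsC b ^+ k) =
  fpsC ((-1) ^+ n * ((1 - a) * a ^+ k + (1 - b) * b ^+ k)).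
Proof. by rewrite !(rmorphM, rmorphD, rmorphXn, rmorphN, rmorph1). Qed.

End FpsConstants.

(** * A closed formula for r2 *)

Lemma unit_fps_one_sub (c a : Qq) i :
  1 - fpsC c * (fpsC a * fpsX Qq) ^+ i.+1 \is a GRing.unit.
Proof.
by rewrite fps_unitE fcoefB fcoefCM fcoefCX mulr0 subr0 fcoef1 unitr1.
Qed.

Lemma q_neq0 : q != 0.
Proof. by rewrite tofrac_eq0 polyX_eq0. Qed.

Local Notation x := (fpsC (- q) * fpsX Qq).

Lemma r2_factorE m : r2_factor m =
  (1 - x ^+ m) ^+ 2 / crank_den x (fpsC (- q)) (fpsC (- q^-1)) m.
Proof. by rewrite /crank_den !one_sub_fpsCN. Qed.

Definition r2_block (N n k : nat) : {poly int} :=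
  (-1) ^+ (n + N + k) *
  ('X^(N + k) + 'X^(N + k.+1) + 'X^(N - k) + 'X^(N - k.+1)).

Lemma r2_block_sign (F : fieldType) (c : F) N n k : c != 0 -> (k < N)%N ->
  (-1) ^+ n * ((1 - - c) * (- c) ^+ k + (1 - - c^-1) * (- c^-1) ^+ k)
    * (- c) ^+ N =
  (-1) ^+ (n + N + k) *
    (c ^+ (N + k) + c ^+ (N + k.+1) + c ^+ (N - k) + c ^+ (N - k.+1)).
Proof.
move=> c_neq0 ltkN; have [d ->] : exists d, N = (d + k.+1)%N.
  by exists (N - k.+1)%N; rewrite subnK.
rewrite addnK (_ : (d + k.+1 - k = d.+1)%N); last by lia.
rewrite ![(- c) ^+ _]exprNn [(- c^-1) ^+ _]exprNn exprVn !(exprD, exprS).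
move: ((-1) ^+ n) ((-1) ^+ k) ((-1) ^+ d) => a b e.
have : c ^+ k != 0 by rewrite expf_neq0.
by move: (c ^+ k) (c ^+ d) => u v u_neq0; field; apply/andP.
Qed.

Lemma fcoef_crank_summand N n e k : (e = N -> k < N)%N ->
  fcoef ((-1) ^+ n * x ^+ e * ((1 - fpsC (- q)) * fpsC (- q) ^+ k
          + (1 - fpsC (- q^-1)) * fpsC (- q^-1) ^+ k)) N =
  (if e == N then r2_block N n k else 0)%:F.
Proof.
move=> ltkN; rewrite mulrAC fps_constE fcoefCM fcoefCX eq_sym.
case: eqP => [e_eq|_]; last by rewrite mulr0 rmorph0.
have {}ltkN := ltkN e_eq; rewrite e_eq.
rewrite r2_block_sign ?q_neq0 // /r2_block.
by rewrite !(rmorphM, rmorphD, rmorphXn, rmorphN, rmorph1).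
Qed.

(** Reading the coefficient of t^N off a product with enough factors, whose
    error term is a multiple of t^(M+1), leaves sums bounded by M. *)
Lemma r2_large N : (0 < N)%N -> exists2 M, (N <= M)%N &
  r2 N = \sum_(n < M) \sum_(k < M | ('C(n.+2, 2) + n.+1 * k == N)%N)
           r2_block N n.+1 k.
Proof.
move=> N_gt0; have [N0 N0P] := r2P N; pose M := maxn N0 N.
exists M; first exact: leq_maxr.
apply/eqP; rewrite -tofrac_eq; apply/eqP; rewrite -[LHS](N0P M) ?leq_maxl //.
under eq_bigr do rewrite r2_factorE.
have Ux i : 1 - x ^+ i.+1 \is a GRing.unit.
  by rewrite -[x ^+ _]mul1r -(rmorph1 (@fpsC Qq)); apply: unit_fps_one_sub.
have zz' : fpsC (- q) * fpsC (- q^-1) = 1.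
  by rewrite -rmorphM mulrNN mulfV ?q_neq0 // rmorph1.
have [h ->] := crank_expansion_mod Ux zz'
  (unit_fps_one_sub _ _) (unit_fps_one_sub _ _) M.
have fcoef_sum I r P (F : I -> fps Qq) :
    fcoef (\sum_(i <- r | P i) F i) N = \sum_(i <- r | P i) fcoef (F i) N.
  by apply: (big_morph (fun f => fcoef f N)).
rewrite !fcoefD fcoef_CXM ?ltnS ?leq_maxr // addr0 fcoef1 gtn_eqF // add0r.
rewrite fcoef_sum rmorph_sum; apply: eq_bigr => n _.
rewrite fcoef_sum rmorph_sum [RHS]big_mkcond; apply: eq_bigr => k _.
rewrite fcoef_crank_summand; first by case: eqP; rewrite ?rmorph0.
have C_gt0 : (0 < 'C(n.+2, 2))%N by rewrite bin_gt0.
by move=> <-; rewrite mulSn; lia.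
Qed.

Lemma crank_exponent_bound N n k :
  ('C(n.+2, 2) + n.+1 * k = N -> n < N /\ k < N)%N.
Proof. by rewrite !binS !bin1 bin0; nia. Qed.

Lemma r2E N : (0 < N)%N ->
  r2 N = \sum_(n < N) \sum_(k < N | ('C(n.+2, 2) + n.+1 * k == N)%N)
           r2_block N n.+1 k.
Proof.
case/r2_large => M leNM ->; rewrite [RHS](big_ord_widen M (fun n =>
  \sum_(k < N | ('C(n.+2, 2) + n.+1 * k == N)%N) r2_block N n.+1 k)) //.
rewrite [RHS]big_mkcond; apply: eq_bigr => n _ /=.
rewrite [X in if _ then X else _](big_ord_widen_cond M
  (fun k => ('C(n.+2, 2) + n.+1 * k == N)%N) (fun k => r2_block N n.+1 k)) //.
case: ltnP => [ltnN|leNn].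
  by apply: eq_bigl => k; case: eqP => //= /crank_exponent_bound[_ ->].
apply: big_pred0 => k; apply/eqP => /crank_exponent_bound[].
by rewrite ltnNge leNn.
Qed.

(** * The signs of the blocks *)

(** The exponents occurring in r2E are thus the factorizations of 2N into two
    factors n+1 < n+2+2k of opposite parity. *)
Lemma crank_exponentE N n k :
  ('C(n.+2, 2) + n.+1 * k == N)%N = (n.+1 * (n.+2 + k.*2) == N.*2)%N.
Proof.
have := mul_bin_diag n.+2 1; rewrite bin1 /= => C_def.
by apply/eqP/eqP; nia.
Qed.

Lemma crank_pair_inj N n n' k :
  (n.+1 * (n.+2 + k.*2) = N -> n'.+1 * (n'.+2 + k.*2) = N -> n = n')%N.
Proof.
by move=> nE n'E; case: (ltngtP n n') => //; nia.
Qed.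

(** A larger k forces a smaller factor n+1; but with n and n+3+2k instead of
    n+1 and n+2+2k the product drops by 2k+2 already. *)
Lemma crank_pair_gap N n n' k :
  (n.+1 * (n.+2 + k.*2) = N -> n'.+1 * (n'.+2 + k.+1.*2) <> N)%N.
Proof.
move=> nE n'E; have [len|ltn] := leqP n n'; first by nia.
have [d dE] : exists d, n = (n' + d).+1 by exists (n - n'.+1)%N; lia.
by subst n; nia.
Qed.

Lemma coef_r2_block N n k j :
  (r2_block N n k)`_(N + j.+1) =
  (-1) ^+ (n + N + k) * ((k == j.+1)%:R + (k == j)%:R).
Proof.
rewrite /r2_block (_ : (-1) ^+ (n + N + k) = ((-1) ^+ (n + N + k))%:P);
  last by rewrite rmorphXn rmorphN1.
rewrite coefCM; congr (_ * _).
rewrite !coefD !coefXn !eqn_add2l eqSS [(j.+1 == k)%N]eq_sym [(j == k)%N]eq_sym.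
by rewrite ![(_ == N - _)%N]gtn_eqF ?addr0 //; lia.
Qed.

(** The exponent N+k+1 occurs only in blocks with parameter k or k+1; the block
    with parameter k is unique and there is none with parameter k+1. *)
Lemma coef_r2_sign N n k : (0 < N)%N -> (n.+1 * (n.+2 + k.*2) = N.*2)%N ->
  (r2 N)`_(N + k.+1) = (-1) ^+ (n.+1 + N + k).
Proof.
move=> N_gt0 nkE; rewrite r2E // coef_sum.
have /eqP nkC : ('C(n.+2, 2) + n.+1 * k == N)%N.
  by rewrite crank_exponentE; apply/eqP.
have [ltnN ltkN] := crank_exponent_bound nkC.
rewrite (bigD1 (Ordinal ltnN)) //= coef_sum (bigD1 (Ordinal ltkN)) /= ?nkC //.
rewrite coef_r2_block eqxx ltn_eqF // add0r mulr1.
have zero n' k' : (n', k') != (n, k) ->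
    ('C(n'.+2, 2) + n'.+1 * k' == N)%N ->
    (r2_block N n'.+1 k')`_(N + k.+1) = 0.
  rewrite crank_exponentE coef_r2_block => neq /eqP nk'E.
  case: eqP => [k'E|_]; first by subst k'; have := crank_pair_gap nkE nk'E.
  case: eqP => [k'E|_]; last by rewrite mulr0.
  by subst k'; rewrite (crank_pair_inj nkE nk'E) eqxx in neq.
rewrite big1 ?addr0 => [|k' /andP[k'N neq]].
  rewrite big1 ?addr0 // => n' neq; rewrite coef_sum big1 // => k' k'N.
  by apply: zero => //; apply: contraNneq neq => -[nE _]; apply/eqP/val_inj.
by apply: zero => //; apply: contraNneq neq => -[kE]; apply/eqP/val_inj.
Qed.

Lemma r2_ge0P N : (0 < N)%N ->
  (forall i, 0 <= (r2 N)`_i) <->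
  (forall n k, (n.+1 * (n.+2 + k.*2) = N.*2)%N -> ~~ odd (n.+1 + N + k)).
Proof.
move=> N_gt0; split=> [r2_ge0 n k nkE | sgn i].
  have := r2_ge0 (N + k.+1)%N; rewrite (coef_r2_sign N_gt0 nkE) -signr_odd.
  by case: odd.
rewrite r2E // coef_sum sumr_ge0 // => n _; rewrite coef_sum sumr_ge0 // => k.
rewrite crank_exponentE => /eqP/sgn/negbTE odd_nk.
rewrite /r2_block -signr_odd odd_nk mul1r !coefD !coefXn.
by rewrite !addr_ge0 ?ler0n.
Qed.

(** The factors n+1 and n+2+2k of 2N are, in some order, a divisor d of N and
    an even number that is 2 modulo 4; in both orders n+1+k is odd exactly when
    d = 1 modulo 4. *)
Lemma crank_signs_divisors N : odd N ->
  (forall n k, (n.+1 * (n.+2 + k.*2) = N.*2)%N -> ~~ odd (n.+1 + N + k)) <->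
  (forall d, (d %| N -> d %% 4 = 1)%N).
Proof.
move=> N_odd; split=> [sgn d /dvdnP[e NE] | divs n k nkE].
  have: odd e && odd d by rewrite -oddM -NE.
  case/andP=> e_odd d_odd.
  have [//|d3] : (d %% 4 = 1 \/ d %% 4 = 3)%N by lia.
  (* With N = e d, the smaller one of d and 2e is n+1. *)
  have [ltde|leed] := ltnP d e.*2.
    pose k := (e.*2 - d)./2.
    have kE : (k.*2 = e.*2 - d.+1)%N by rewrite /k; lia.
    have := sgn d.-1 k; rewrite prednK ?kE; last by lia.
    rewrite (_ : (d.+1 + _ = e.*2)%N); last by lia.
    rewrite -doubleMr mulnC -NE => /(_ erefl); lia.
  pose k := (d - e.*2)./2.
  have kE : (k.*2 = d - e.*2.+1)%N by rewrite /k; lia.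
  have := sgn e.*2.-1 k; rewrite prednK ?kE; last by lia.
  rewrite (_ : (e.*2.+1 + _ = d)%N); last by lia.
  rewrite -doubleMl -NE => /(_ erefl); lia.
have [a_odd|a_even] := boolP (odd n.+1).
  have mE : (n.+2 + k.*2 = (n.+2 + k.*2)./2.*2)%N by lia.
  move: nkE; rewrite mE -doubleMr => /double_inj NE.
  have /divs : (n.+1 %| N)%N by rewrite -NE dvdn_mulr.
  have /divs : ((n.+2 + k.*2)./2 %| N)%N by rewrite -NE dvdn_mull.
  by lia.
have aE : (n.+1 = n.+1./2.*2)%N by lia.
have NE : (n.+1./2 * (n.+2 + k.*2))%N = N.
  by apply: double_inj; rewrite -nkE doubleMl -aE.
have /divs : (n.+1./2 %| N)%N by rewrite -NE dvdn_mulr.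
have /divs : (n.+2 + k.*2 %| N)%N by rewrite -NE dvdn_mull.
by lia.
Qed.

(** * Sums of two squares *)

Lemma Fp_fermat p (y : 'F_p) : prime p -> y != 0 -> y ^+ p.-1 = 1.
Proof.
move=> p_pr y_neq0; apply: (mulfI y_neq0).
rewrite -exprS prednK ?prime_gt0 // mulr1.
by have := expf_card y; rewrite card_Fp.
Qed.

(** As 'X^((p-1)/2) - 1 has at most (p-1)/2 roots, y^((p-1)/2) = -1 for a y <> 0,
    and the exponent (p-1)/2 is even. *)
Lemma sqrt_opp1_modp p : prime p -> (p %% 4 = 1)%N ->
  exists r, (p %| r ^ 2 + 1)%N.
Proof.
move=> p_pr p1; pose s : seq 'F_p := enum [set~ 0].
have p_gt1 := prime_gt1 p_pr.
have sz : size s = p.-1 by rewrite -cardE cardsC1 card_Fp.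
have [s_all|] := boolP (all (root ('X^(p.-1./2) - 1)) s).
  have szX : size ('X^(p.-1./2) - 1 : {poly 'F_p}) = (p.-1./2).+1.
    by rewrite size_XnsubC //; lia.
  have := max_poly_roots _ s_all (enum_uniq _).
  by rewrite -size_poly_eq0 szX sz => /(_ isT); lia.
case/allPn => y; rewrite mem_enum in_setC1 => y_neq0.
rewrite rootE !hornerE subr_eq0 => ne1.
have : (y ^+ (p.-1./2)) ^+ 2 = 1.
  rewrite -exprM (_ : (p.-1./2 * 2 = p.-1)%N); last by lia.
  exact: Fp_fermat.
move/eqP; rewrite sqrf_eq1 (negbTE ne1) /= => /eqP yN1.
exists (y ^+ (p %/ 4) : 'F_p); rewrite (dvdn_pcharf (pchar_Fp p_pr)).
rewrite natrD natrX natr_Zp -exprM (_ : (p %/ 4 * 2 = p.-1./2)%N); last by lia.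
by rewrite yN1 addNr.
Qed.

Lemma sqrt_floor m : exists s, (s ^ 2 <= m < s.+1 ^ 2)%N.
Proof.
elim: m => [|m [s sP]]; first by exists 0%N.
have [lt|ge] := ltnP m.+1 (s.+1 ^ 2)%N; [exists s | exists s.+1]; lia.
Qed.

Lemma small_sum_two_squares (p s : nat) (a b w : int) : (s ^ 2 < p)%N ->
  `|a| <= s%:Z -> `|b| <= s%:Z -> (a != 0) || (b != 0) ->
  a ^+ 2 + b ^+ 2 = p%:Z * w -> a ^+ 2 + b ^+ 2 = p%:Z.
Proof.
move=> s_lt a_le b_le ab_neq0 wE.
have sq_le (c : int) : `|c| <= s%:Z -> c ^+ 2 <= s%:Z ^+ 2.
  by move=> ?; rewrite -real_normK ?num_real // lerXn2r ?nnegrE.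
have sqP : 0 < a ^+ 2 + b ^+ 2.
  rewrite lt0r paddr_eq0 ?sqr_ge0 // !sqrf_eq0 negb_and ab_neq0.
  by rewrite addr_ge0 ?sqr_ge0.
have ltp : s%:Z ^+ 2 < p%:Z by rewrite expr2 -PoszM mulnn ltz_nat.
have := sq_le _ a_le; have := sq_le _ b_le; rewrite wE in sqP *.
move: (a ^+ 2) (b ^+ 2) (s%:Z ^+ 2) wE ltp sqP => A B S wE ltp sqP leB leA.
have w_gt0 : 0 < w by nia.
have w_lt2 : w < 2 by nia.
by rewrite (_ : w = 1) ?mulr1 //; lia.
Qed.

(** The argument of Thue: among the more than p pairs (x, y) with entries at
    most the square root of p, two have the same x + r y modulo p, where
    r^2 = -1; their difference (a, b) satisfies a^2 + b^2 = 0 modulo p and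
    0 < a^2 + b^2 < 2p. *)
Lemma prime_sum_two_squares p : prime p -> (p %% 4 = 1)%N ->
  exists a b, (a ^ 2 + b ^ 2 = p)%N.
Proof.
move=> p_pr p1; have [r /dvdnP[c r_sq]] := sqrt_opp1_modp p_pr p1.
have p_gt0 := prime_gt0 p_pr.
have [s /andP[s_le lt_s]] := sqrt_floor p.
have s_lt : (s ^ 2 < p)%N.
  rewrite ltn_neqAle s_le andbT; apply: contraTneq p_pr => <-.
  rewrite -mulnn; case: s {s_le lt_s} => [|[|s]] //.
  by apply/primePn; right; exists s.+2; rewrite ?dvdn_mulr //; nia.
pose f (xy : 'I_s.+1 * 'I_s.+1) : 'I_p :=
  Ordinal (ltn_pmod (xy.1 + r * xy.2) p_gt0).
have /injectivePn[[x y] [[x' y'] neq fE]] : ~~ injectiveb f.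
  apply/negP => /injectiveP/leq_card.
  by rewrite card_prod !card_ord leqNgt mulnn lt_s.
have {fE} := congr1 val fE; rewrite /= => fE.
have := divn_eq (x + r * y) p; rewrite fE.
have := divn_eq (x' + r * y') p.
move: (_ %% p)%N (_ %/ p)%N (_ %/ p)%N => z t t' xE' xE.
pose a := x%:Z - x'%:Z; pose b := y%:Z - y'%:Z.
have [w wE] : exists w, a ^+ 2 + b ^+ 2 = p%:Z * w.
  (* a = p (t - t') - r b and r^2 + 1 = c p. *)
  exists (p%:Z * (t%:Z - t'%:Z) ^+ 2 - 2 * (t%:Z - t'%:Z) * r%:Z * b
          + c%:Z * b ^+ 2).
  have aE : a = p%:Z * (t%:Z - t'%:Z) - r%:Z * b.
    transitivity ((x%:Z + r%:Z * y%:Z) - (x'%:Z + r%:Z * y'%:Z) - r%:Z * b).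
      by rewrite /a /b; ring.
    have := congr1 Posz xE; have := congr1 Posz xE'.
    by rewrite !PoszD !PoszM => -> ->; ring.
  have cE : c%:Z * p%:Z = r%:Z ^+ 2 + 1 by rewrite -PoszM -r_sq; lia.
  by rewrite aE; ring: cE.
have small (u v : 'I_s.+1) : `|u%:Z - v%:Z| <= s%:Z.
  by have := ltn_ord u; have := ltn_ord v; clear; lia.
have ab_neq0 : (a != 0) || (b != 0).
  rewrite -negb_and; apply: contraNN neq.
  move=> /andP[/eqP/subr0_eq[a0] /eqP/subr0_eq[b0]].
  by rewrite xpair_eqE; apply/andP; split; apply/eqP/val_inj.
have abE :=
  small_sum_two_squares s_lt (small _ _) (small _ _) ab_neq0 wE.
by exists `|a|%N, `|b|%N; clear -abE; lia.
Qed.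

Lemma common_prime_divisor m n : gcdn m n != 1%N ->
  exists l, [/\ prime l, (l %| m)%N & (l %| n)%N].
Proof.
move=> g_neq1; suff [l l_pr] : exists2 l, prime l & (l %| gcdn m n)%N.
  by rewrite dvdn_gcd => /andP[lm ln]; exists l.
have [->|g_gt0] := posnP (gcdn m n); first by exists 2%N.
by exists (pdiv (gcdn m n)); rewrite ?pdiv_dvd // pdiv_prime; lia.
Qed.

Lemma Euclid_dvdzM (l : nat) (a b : int) : prime l ->
  (l %| a * b)%Z = (l %| a)%Z || (l %| b)%Z.
Proof. by move=> l_pr; rewrite !dvdzE abszM Euclid_dvdM. Qed.

Lemma odd_prime_dvdz2 (l : nat) (a : int) : prime l -> odd l ->
  (l %| 2 * a)%Z -> (l %| a)%Z.
Proof.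
move=> l_pr l_odd; rewrite Euclid_dvdzM // => /orP[|//].
by rewrite dvdzE /= dvdn_prime2 // => /eqP l2; rewrite l2 in l_odd.
Qed.

Definition coprime_squares_sum (n : nat) :=
  exists a b : int, [/\ a ^+ 2 + b ^+ 2 = n%:Z &
    forall l : nat, prime l -> (l %| a)%Z -> (l %| b)%Z -> False].

(** With n = a^2 + b^2, the two candidates are the norms of (a + bi)(c + di)
    and of (a + bi)(c - di).  A common prime factor of the components of either
    one can only be p, since it divides a p and b p; and p cannot divide all
    four components, since it would then divide ac, ad, bc and bd, hence either
    both of c and d, which p^2 > p excludes, or both of a and b. *)
Lemma coprime_squares_sum_mul (p n : nat) (c d : int) :
    prime p -> odd p -> c ^+ 2 + d ^+ 2 = p%:Z ->
  coprime_squares_sum n -> coprime_squares_sum (p * n).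
Proof.
move=> p_pr p_odd cdE [a [b [abE ab_cop]]].
have common_p (l : nat) :
    prime l -> (l %| a * p%:Z)%Z -> (l %| b * p%:Z)%Z -> l = p.
  move=> l_pr; rewrite !Euclid_dvdzM // => /orP[la|+ _].
    move=> /orP[lb|]; first by case: (ab_cop l).
    by rewrite dvdzE dvdn_prime2 // => /eqP.
  by rewrite dvdzE dvdn_prime2 // => /eqP.
have [dvd1|ndvd1] :=
  boolP ((p %| a * c - b * d)%Z && (p %| a * d + b * c)%Z); last first.
  exists (a * c - b * d), (a * d + b * c); split.
    by rewrite PoszM -abE -cdE; ring.
  move=> l l_pr l1 l2; case/negP: ndvd1; suff <- : l = p by rewrite l1.
  apply: common_p => //; rewrite -cdE.
    rewrite (_ : _ * _ =
      c * (a * c - b * d) + d * (a * d + b * c)); last by ring.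
    by rewrite rpredD // dvdz_mull.
  rewrite (_ : _ * _ =
    c * (a * d + b * c) - d * (a * c - b * d)); last by ring.
  by rewrite rpredB // dvdz_mull.
exists (a * c + b * d), (a * d - b * c); split.
  by rewrite PoszM -abE -cdE; ring.
case/andP: dvd1 => p1 p2 l l_pr l3 l4.
have lp : l = p.
  apply: common_p => //; rewrite -cdE.
    rewrite (_ : _ * _ =
      c * (a * c + b * d) + d * (a * d - b * c)); last by ring.
    by rewrite rpredD // dvdz_mull.
  rewrite (_ : _ * _ =
    d * (a * c + b * d) - c * (a * d - b * c)); last by ring.
  by rewrite rpredB // dvdz_mull.
subst l.
have pac : (p %| a * c)%Z.
  apply: odd_prime_dvdz2 => //.
  by rewrite (_ : _ * _ =
    (a * c - b * d) + (a * c + b * d)); [rewrite rpredD | ring].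
have pad : (p %| a * d)%Z.
  apply: odd_prime_dvdz2 => //.
  by rewrite (_ : _ * _ =
    (a * d + b * c) + (a * d - b * c)); [rewrite rpredD | ring].
have pbc : (p %| b * c)%Z.
  by rewrite (_ : b * c = (a * d + b * c) - a * d); [rewrite rpredB | ring].
have pbd : (p %| b * d)%Z.
  by rewrite (_ : b * d = a * c - (a * c - b * d)); [rewrite rpredB | ring].
have ncd : ~~ ((p %| c)%Z && (p %| d)%Z).
  apply/negP => /andP[/dvdzP[u cE] /dvdzP[v dE]].
  have /eqP : p%:Z * (p%:Z * (u ^+ 2 + v ^+ 2) - 1) = 0.
    by rewrite mulrBr mulr1 -[X in _ - X]cdE cE dE; ring.
  rewrite mulf_eq0 subr_eq0 => /orP[|/eqP pE].
    by rewrite eqz_nat => /eqP p0; rewrite p0 in p_pr.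
  have := dvdz_mulr (u ^+ 2 + v ^+ 2) (dvdzz p%:Z).
  by rewrite pE dvdzE dvdn1 absz_nat => /eqP pE1; rewrite pE1 in p_pr.
rewrite !Euclid_dvdzM // in pac pad pbc pbd.
have [cp|cp] := boolP (p %| c)%Z.
  rewrite cp /= in ncd; rewrite (negbTE ncd) !orbF in pad pbd.
  by case: (ab_cop p).
by rewrite (negbTE cp) !orbF in pac pbc; case: (ab_cop p).
Qed.

Lemma coprime_squares_sum_1mod4 n : (0 < n)%N ->
  (forall d, (d %| n -> d %% 4 = 1)%N) -> coprime_squares_sum n.
Proof.
elim/ltn_ind: n => n IHn n_gt0 n_div.
have [n_le1|n_gt1] := leqP n 1.
  have -> : n = 1%N by lia.
  exists 1, 0; split=> // l l_pr; rewrite dvdzE dvdn1 absz_nat => /eqP l1.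
  by rewrite l1 in l_pr.
have p_pr := pdiv_prime n_gt1; have p_dvd := pdiv_dvd n.
have p1 := n_div _ p_dvd; have [a [b abE]] := prime_sum_two_squares p_pr p1.
rewrite -(divnK p_dvd) mulnC; apply: (@coprime_squares_sum_mul _ _ a b) => //.
- by lia.
- by rewrite -abE; lia.
apply: IHn; rewrite ?divn_gt0 ?pdiv_gt0 ?pdiv_leq ?ltn_Pdiv ?prime_gt1 //.
move=> d d_dvd.
by apply: n_div; rewrite (dvdn_trans d_dvd) // dvdn_div.
Qed.

Lemma primitive_hypotenuse_of_squares n : odd n -> (1 < n)%N ->
  coprime_squares_sum n -> primitive_hypotenuse n.
Proof.
move=> n_odd n_gt1 [a [b [abE ab_cop]]].
exists (absz (a ^+ 2 - b ^+ 2)), (absz (2 * (a * b))).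
have prime_n l :
    prime l -> (l %| n)%N -> (l %| absz (a ^+ 2 - b ^+ 2)%R)%N -> False.
  move=> l_pr ln; have l_odd : odd l by apply: dvdn_odd n_odd.
  have ln' : (l %| a ^+ 2 + b ^+ 2)%Z by rewrite abE dvdzE.
  move=> lab; have {}lab : (l %| a ^+ 2 - b ^+ 2)%Z by rewrite dvdzE.
  apply: (ab_cop l l_pr).
    suff : (l %| a * a)%Z by rewrite Euclid_dvdzM // orbb.
    apply: odd_prime_dvdz2 => //.
    by rewrite (_ : 2 * _ =
      (a ^+ 2 + b ^+ 2) + (a ^+ 2 - b ^+ 2)); [rewrite rpredD | ring].
  suff : (l %| b * b)%Z by rewrite Euclid_dvdzM // orbb.
  apply: odd_prime_dvdz2 => //.
  by rewrite (_ : 2 * _ =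
    (a ^+ 2 + b ^+ 2) - (a ^+ 2 - b ^+ 2)); [rewrite rpredB | ring].
split.
- rewrite lt0n; apply/eqP => ab0.
  case: (prime_n (pdiv n)); rewrite ?pdiv_prime ?pdiv_dvd //.
  by rewrite ab0.
- have unit_case c : c ^+ 2 = n%:Z ->
      (forall l : nat, prime l -> ~~ (l %| c)%Z) -> False.
    move=> cE c_free; have [c1|c_neq1] := eqVneq `|c|%N 1%N.
      have [c_eq|c_eq] : c = 1 \/ c = -1 by lia.
        by move: cE; rewrite c_eq; lia.
      by move: cE; rewrite c_eq; lia.
    have c_gt1 : (1 < `|c|)%N.
      rewrite ltn_neqAle eq_sym c_neq1 lt0n absz_eq0; apply/eqP => c0.
      by move: cE; rewrite c0; lia.
    by have := c_free _ (pdiv_prime c_gt1); rewrite dvdzE absz_nat pdiv_dvd.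
  rewrite lt0n absz_eq0 !mulf_eq0 /=; apply/norP; split; apply/eqP => c0.
    apply: (unit_case b); first by rewrite -abE c0 expr0n add0r.
    by move=> l l_pr; apply/negP; apply: ab_cop; rewrite ?c0 ?dvdz0.
  apply: (unit_case a); first by rewrite -abE c0 expr0n addr0.
  by move=> l l_pr; apply/negP => la; apply: (ab_cop l); rewrite ?c0 ?dvdz0.
- apply/eqP; rewrite -eqz_nat PoszD; apply/eqP.
  have sqz (m : nat) : (m ^ 2)%N%:Z = m%:Z ^+ 2 by rewrite -mulnn PoszM expr2.
  by rewrite !sqz !abszE !real_normK ?num_real // -abE; ring.
apply/eqP/contraT => /common_prime_divisor[l [l_pr]].
by rewrite dvdn_gcd => /andP[lab _] /(prime_n l l_pr)/(_ lab).
Qed.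

(** For p = 3 modulo 4, the exponent (p-1)/2 is odd, so raising the equation
    u^2 = - v^2 in 'F_p to it gives 1 = -1 unless u = 0; hence p would divide
    both u and v. *)
Lemma prime_divisor_hypotenuse n p : odd n -> primitive_hypotenuse n ->
  prime p -> (p %| n)%N -> (p %% 4 = 1)%N.
Proof.
move=> n_odd [u [v [_ _ uvE uv_cop]]] p_pr pn.
have p_odd : odd p by apply: dvdn_odd n_odd.
have [//|p3] : (p %% 4 = 1 \/ p %% 4 = 3)%N by lia.
have natFp m : ((m%:R : 'F_p) == 0) = (p %| m)%N.
  by rewrite (dvdn_pcharf (pchar_Fp p_pr)).
have sq0 : (u%:R : 'F_p) ^+ 2 + v%:R ^+ 2 = 0.
  by rewrite -!natrX -natrD uvE; apply/eqP; rewrite natFp dvdn_exp.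
have u0 : (u%:R : 'F_p) = 0.
  apply/eqP/contraT => u_neq0; set U : 'F_p := u%:R in sq0 u_neq0.
  set V : 'F_p := v%:R in sq0.
  have V_neq0 : V != 0.
    apply: contraNneq u_neq0 => V0; move/eqP: sq0.
    by rewrite V0 expr0n addr0 sqrf_eq0.
  have half : (p.-1 = 2 * p.-1./2)%N by lia.
  have half_odd : odd p.-1./2 by lia.
  have : (- V ^+ 2) ^+ p.-1./2 = -1.
    by rewrite exprNn -signr_odd half_odd -exprM -half Fp_fermat // mulr1.
  have -> : - V ^+ 2 = U ^+ 2.
    by apply/eqP; rewrite eq_sym -subr_eq0 opprK sq0.
  rewrite -exprM -half Fp_fermat // => /eqP.
  rewrite -subr_eq0 opprK -(natrD _ 1 1) natFp.
  move/(dvdn_leq (isT : (0 < 2)%N)) => p_le2.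
  by have := prime_gt1 p_pr; lia.
move/eqP: sq0; rewrite u0 expr0n add0r sqrf_eq0 natFp => pv.
have pu : (p %| u)%N by rewrite -natFp u0.
have : (p %| gcdn (gcdn u v) n)%N by rewrite !dvdn_gcd pu pv.
by rewrite uv_cop dvdn1 => /eqP p_eq1; rewrite p_eq1 in p_pr.
Qed.

Lemma divisors_1mod4 n : (0 < n)%N ->
    (forall p, prime p -> p %| n -> p %% 4 = 1)%N ->
  (forall d, d %| n -> d %% 4 = 1)%N.
Proof.
move=> n_gt0 prime_n; elim/ltn_ind => d IHd d_dvd.
have d_gt0 := dvdn_gt0 n_gt0 d_dvd.
have [d_le1|d_gt1] := leqP d 1; first by have -> : d = 1%N by lia.
have p_dvd := pdiv_dvd d.
have p1 : (pdiv d %% 4 = 1)%N.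
  by apply: prime_n; [rewrite pdiv_prime | apply: dvdn_trans p_dvd d_dvd].
have dp1 : ((d %/ pdiv d) %% 4 = 1)%N.
  apply: IHd; first by rewrite ltn_Pdiv // prime_gt1 ?pdiv_prime.
  by rewrite (dvdn_trans _ d_dvd) // dvdn_div.
by rewrite -(divnK p_dvd) -modnMm p1 dp1.
Qed.

Lemma primitive_hypotenuseP n : odd n -> (1 < n)%N ->
  primitive_hypotenuse n <-> (forall d, d %| n -> d %% 4 = 1)%N.
Proof.
move=> n_odd n_gt1; have n_gt0 := ltnW n_gt1; split=> [hyp | n_div].
  by apply: divisors_1mod4 => // p p_pr; apply: prime_divisor_hypotenuse.
exact/primitive_hypotenuse_of_squares/coprime_squares_sum_1mod4.
Qed.

Theorem corollary2 (n : nat) (n_odd : odd n) (n_gt1 : (1 < n)%N) :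
  primitive_hypotenuse n <-> (forall i : nat, 0 <= (r2 n)`_i).
Proof.
rewrite (primitive_hypotenuseP n_odd n_gt1) -(crank_signs_divisors n_odd).
by rewrite -(r2_ge0P (ltnW n_gt1)).
Qed.
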